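(* Let $(\Omega,\mathcal{F})$ be a measurable space, $\mathcal{P}$ a family of probability measures on it, and $\mathbb{E}[\cdot]:=\sup_{P\in\mathcal{P}}E_P[\cdot]$ the associated upper (sublinear) expectation. Let $\{\epsilon_i\}_{i\ge1}$ and $\{\eta_i\}_{i\ge1}$ be real random variables such that, under each $P\in\mathcal{P}$, $\{\epsilon_i\}$ is i.i.d., $\{\eta_i\}$ is i.i.d., and $\{\eta_i\}$ is independent of $\{\epsilon_i\}$. Assume that for some $\alpha\in(0,1]$: $\mathbb{E}[\epsilon_1^2]=\overline{\sigma}^2$, $-\mathbb{E}[-\epsilon_1^2]=\underline{\sigma}^2>0$, $\mathbb{E}[|\epsilon_1|^{2+2\alpha}]<\infty$; $\mathbb{E}[\eta_1]=\mathbb{E}[-\eta_1]=0$, $\mathbb{E}[\eta_1^2]=\overline{\nu}^2$, $-\mathbb{E}[-\eta_1^2]=\underline{\nu}^2>0$, $\mathbb{E}[|\eta_1|^{2+2\alpha}]<\infty$. Let $0<\underline{\zeta}<\overline{\zeta}<\infty$ be constants. Let $\mathcal{F}_0:=\{\emptyset,\Omega\}$, $\mathcal{F}_i:=\sigma(\epsilon_1,\dots,\epsilon_i,\eta_1,\dots,\eta_i)$, and for $n\in\mathbb{N}$ let $\Sigma[\underline{\zeta},\overline{\zeta}]$ be the collection of all sequences $X=\{X_i\}_{i=1}^n$ with $X_i$ $\mathcal{F}_{i-1}$-measurable and taking values in $[\underline{\zeta},\overline{\zeta}]$. Given $p>0$, define \[ C_{\alpha}:=\big(32\overline{\zeta}^{2+2\alpha}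 \mathbb{E}[|\epsilon_1|^{2+2\alpha}]+32 \mathbb{E}[|\eta_1|^{2+2\alpha}]\big)^{\frac{1}{1+\alpha}},\qquad \gamma_n:=\underline{\sigma}^2\underline{\zeta}^2+\underline{\nu}^2-\frac{C_{\alpha}}{p\, n^{\frac{\alpha}{1+\alpha}}}. \] Then for every $n\in\mathbb{N}$, the test which rejects the null hypothesis $\mathcal{H}_0$ when $\sum_{i=1}^nY_i^2\le n\gamma_n$ has upper probability of missed detections at most $p$, i.e. \[ \sup_{P\in\mathcal{P}}\ \sup_{X\in\Sigma[\underline{\zeta},\overline{\zeta}]}\ P\Big(\sum_{i=1}^{n}(\epsilon_iX_i+\eta_i)^2\leq n\gamma_n\Big)\leq p. \]
   Context: Detection setting: the observations are $Y_1,\dots,Y_n$, and the binary hypothesis test is $\mathcal{H}_0: Y_i=\epsilon_iX_i+\eta_i$ ($i=1,\dots,n$) versus $\mathcal{H}_1: Y_i=\eta_i$ ($i=1,\dots,n$), where $\epsilon_i$ is channel fading, $\eta_i$ noise and $X=\{X_i\}$ the (feedback-dependent, predictable) input. A missed detection is choosing $\mathcal{H}_1$ when $\mathcal{H}_0$ holds; its upper probability is the supremum over $P\in\mathcal{P}$ and $X\in\Sigma[\underline\zeta,\overline\zeta]$ of the probability under $\mathcal{H}_0$ of choosing $\mathcal{H}_1$. *)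

(* Defs.v *)
From HB Require Import structures.
From mathcomp Require Import all_boot all_order all_algebra.
From mathcomp Require Import all_classical all_reals all_analysis.
Set Implicit Arguments. Unset Strict Implicit. Unset Printing Implicit Defensive.
Import Order.TTheory GRing.Theory Num.Theory.
Import numFieldNormedType.Exports.
Local Open Scope classical_set_scope.
Local Open Scope ring_scope.

Section Defs.
Context {d : measure_display} {T : measurableType d} {R : realType}.

Definition upper_E (Pfam : set (probability T R)) (f : T -> R) : \bar R :=
  ereal_sup [set (\int[P]_x (f x)%:E)%E | P in Pfam].

Definition gen_sigma (I : set nat) (Z : nat -> T -> R) : set (set T) :=
  <<s [set A | exists j (B : set R), I j /\ measurable B /\ A = Z j @^-1` B] >>.

(* F_i := sigma(eps_1..eps_i, eta_1..eta_i) (0-indexed: eps 0 .. eps (i-1));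
   F_0 = {emptyset, Omega} (sigma-algebra generated by the empty family). *)
Definition filtr (eps eta : nat -> T -> R) (i : nat) : set (set T) :=
  <<s [set A | exists j (B : set R), (j < i)%N /\ measurable B /\
                 (A = eps j @^-1` B \/ A = eta j @^-1` B)] >>.

Definition measurable_wrt (G : set (set T)) (f : T -> R) : Prop :=
  forall B : set R, measurable B -> G (f @^-1` B).

Definition mutually_independent (P : probability T R) (Z : nat -> T -> R) :=
  forall (J : seq nat) (B : nat -> set R), uniq J ->
    (forall j, j \in J -> measurable (B j)) ->
    P (\bigcap_(j in [set j | j \in J]) (Z j @^-1` B j)) =
      (\prod_(j <- J) P (Z j @^-1` B j))%E.

Definition identically_distributed (P : probability T R) (Z : nat -> T -> R) :=
  forall i (B : set R), measurable B -> P (Z i @^-1` B) = P (Z 0%N @^-1` B).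

Definition iid (P : probability T R) (Z : nat -> T -> R) :=
  mutually_independent P Z /\ identically_distributed P Z.

Definition indep_seq (P : probability T R) (Z1 Z2 : nat -> T -> R) :=
  forall A B, gen_sigma setT Z1 A -> gen_sigma setT Z2 B ->
    P (A `&` B) = (P A * P B)%E.

Definition Sigma_inputs (eps eta : nat -> T -> R) (zlo zhi : R) (n : nat)
  : set (nat -> T -> R) :=
  [set X | forall i, (i < n)%N ->
      measurable_wrt (filtr eps eta i) (X i) /\
      (forall w, zlo <= X i w <= zhi)].

End Defs.

(* Main.v *)
(** Chernoff's method for the lower tail of a sum of nonnegative terms.  Put
[q = 1 + alpha] and [Z_i = (eps_i X_i + eta_i)^2].  From
[exp (- x) <= 1 - x + x^q] for [x >= 0], and since [eta_i] is centred and
independent of [eps_i] and of the past, integrating out first [eta_i] and then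
[eps_i] shows that the conditional expectation of [exp (- l Z_i)] given the past
is at most [exp (- l m + 16 l^q K)], where [m = zlo^2 sig_lo^2 + nu_lo^2] and
[K = zhi^(2q) E|eps|^(2q) + E|eta|^(2q)].  Multiplying these bounds and applying
Markov's inequality at the level [n gamma_n] with [l = (32 n K)^(-1/q)] gives
the tail bound [exp (- 1/p + 1/2)], which is at most [p]. *)
Require Import Defs.
From HB Require Import structures.
From mathcomp Require Import all_boot all_order all_algebra.
From mathcomp Require Import all_classical all_reals all_analysis.
From mathcomp Require Import ring lra measurable_realfun.
Import Order.TTheory GRing.Theory Num.Theory.
Import numFieldNormedType.Exports.
Local Open Scope classical_set_scope.
Local Open Scope ring_scope.

(** * Independence of the present variable from the past *)

Section independence.
Context {d : measure_display} {T : measurableType d} {R : realType}.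
Implicit Types (P : probability T R) (Z : nat -> T -> R).

(** The restriction of [P] to [B] and the multiple of [P] by [P B] are finite measures that agree on
    the pi-system [G], hence on the sigma-algebra it generates. *)
Lemma g_sigma_algebra_indep P (G : set (set T)) (B : set T) :
  measurable B -> G `<=` measurable -> setI_closed G -> G setT ->
  (forall A, G A -> P (A `&` B) = (P A * P B)%E) ->
  forall A, <<s G >> A -> P (A `&` B) = (P A * P B)%E.
Proof.
move=> mB Gm GI GT GB A sA.
have PB0 : 0 <= fine (P B) by exact: fine_ge0.
have E : (mrestr P mB : set T -> \bar R) A = mscale (NngNum PB0) P A.
  apply: (g_sigma_algebra_measure_unique G Gm (fun=> setT)) => //.
  - by rewrite bigcup_const.
  - move=> C GC; rewrite /= /mrestr /mscale GB//= fineK ?fin_num_measure//.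
    by rewrite muleC.
  - by move=> _; rewrite /= /mrestr; apply: (le_lt_trans (probability_le1 _ _));
      [exact: measurableI|rewrite ltry].
by move: E; rewrite /= /mrestr /mscale /= fineK ?fin_num_measure// muleC.
Qed.

Definition cylinders Z (n : nat) : set (set T) :=
  [set A | exists2 B : nat -> set R, (forall j, measurable (B j)) &
                 A = \bigcap_(j in `I_n) (Z j @^-1` B j)].

(* The rectangles generating the joint past of [Z] up to (excluding) time [n]
   and of the whole sequence [Z']. *)
Definition history Z Z' n : set (set T) :=
  [set A `&` D | A in cylinders Z n & D in gen_sigma setT Z'].

Lemma gen_sigma_measurable Z : (forall i, measurable_fun setT (Z i)) ->
  gen_sigma setT Z `<=` measurable.
Proof.
move=> mZ; apply: smallest_sub; first exact: sigma_algebra_measurable.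
by move=> _ [j [B [_ [mB ->]]]]; rewrite -[X in measurable X]setTI; exact: mZ.
Qed.

Lemma gen_sigmaI Z : setI_closed (gen_sigma setT Z).
Proof.
have /sigma_algebraP : sigma_algebra setT (gen_sigma setT Z).
  exact: smallest_sigma_algebra.
by case=> // A B AS.
Qed.

Lemma gen_sigma_preimage Z j B : measurable B -> gen_sigma setT Z (Z j @^-1` B).
Proof. by move=> mB; apply: sub_sigma_algebra; exists j, B. Qed.

Lemma gen_sigmaT Z : gen_sigma setT Z setT.
Proof. by rewrite -(preimage_setT (Z 0%N)); exact: gen_sigma_preimage. Qed.

Lemma gen_sigma_cylinders Z n : cylinders Z n `<=` gen_sigma setT Z.
Proof.
move=> _ [B mB ->].
pose G := [set A | exists j (B : set R),
  [set: nat] j /\ measurable B /\ A = Z j @^-1` B].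
suff : G.-sigma.-measurable (\bigcap_(j in `I_n) (Z j @^-1` B j)) by [].
apply: bigcap_measurableType => j _; exact: gen_sigma_preimage.
Qed.

Lemma cylindersI Z n : setI_closed (cylinders Z n).
Proof.
move=> _ _ [B mB ->] [C mC ->]; exists (fun j => B j `&` C j).
  by move=> j; exact: measurableI.
by rewrite -bigcapI; apply: eq_bigcapr => j _; rewrite preimage_setI.
Qed.

Lemma cylindersT Z n : cylinders Z n setT.
Proof.
by exists (fun=> setT) => //; apply/seteqP; split.
Qed.

Lemma historyI Z Z' n : setI_closed (history Z Z' n).
Proof.
move=> _ _ [A cA [D sD <-]] [B cB [E sE <-]].
exists (A `&` B); first exact: cylindersI.
by exists (D `&` E); [exact: gen_sigmaI|rewrite setIACA].
Qed.

Lemma historyT Z Z' n : history Z Z' n setT.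
Proof.
exists setT; first exact: cylindersT.
by exists setT; [exact: gen_sigmaT|rewrite setTI].
Qed.

Lemma history_measurable Z Z' n : (forall i, measurable_fun setT (Z i)) ->
  (forall i, measurable_fun setT (Z' i)) -> history Z Z' n `<=` measurable.
Proof.
move=> mZ mZ' _ [A cA [D sD <-]]; apply: measurableI.
  by apply: (gen_sigma_measurable Z mZ); exact: gen_sigma_cylinders cA.
exact: (gen_sigma_measurable Z' mZ').
Qed.

(** Mutual independence is used twice, for the indices below [n.+1] and for those below [n]; the two
    products differ by the factor of index [n]. *)
Lemma cylinders_indep P Z n A B : mutually_independent P Z ->
  cylinders Z n A -> measurable B ->
  P (A `&` Z n @^-1` B) = (P A * P (Z n @^-1` B))%E.
Proof.
move=> indZ [C mC ->] mB.
(* Placing [B] at index [n] turns the intersection into a single finite rectangle. *)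
pose C' j := if j == n then B else C j.
have C'E j : (j < n)%N -> C' j = C j by rewrite /C'; case: ltngtP.
have mem m : [set j | j \in iota 0 m] = `I_m.
  by apply/seteqP; split => j /=; rewrite mem_iota.
have capE : \bigcap_(j in `I_n) (Z j @^-1` C j) `&` Z n @^-1` B =
    \bigcap_(j in [set j | j \in iota 0 n.+1]) (Z j @^-1` C' j).
  rewrite mem [RHS]bigcap_mkord big_ord_recr/=.
  rewrite -(bigcap_mkord n (fun i => Z i @^-1` C' i)) {2}/C' eqxx; congr (_ `&` _).
  by apply: eq_bigcapr => j /= jn; rewrite C'E.
rewrite capE indZ ?iota_uniq//; last by move=> j _; rewrite /C'; case: ifP.
rewrite -[n.+1]addn1 iotaD big_cat/= big_seq1 add0n {2}/C' eqxx; congr (_ * _)%E.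
rewrite -mem indZ ?iota_uniq// big_seq [RHS]big_seq; apply: eq_bigr => j.
by rewrite mem_iota => /andP[_ jn]; rewrite C'E.
Qed.

(** By the pi-system argument it suffices to treat a rectangle, made of a cylinder of [Z] and an
    event of [Z']. *)
Lemma history_indep P Z Z' n A B : (forall i, measurable_fun setT (Z i)) ->
  (forall i, measurable_fun setT (Z' i)) ->
  mutually_independent P Z -> indep_seq P Z Z' ->
  <<s history Z Z' n >> A -> measurable B ->
  P (A `&` Z n @^-1` B) = (P A * P (Z n @^-1` B))%E.
Proof.
move=> mZ mZ' indZ indZZ' + mB; apply: g_sigma_algebra_indep.
- by rewrite -[X in measurable X]setTI; exact: mZ.
- exact: history_measurable.
- exact: historyI.
- exact: historyT.
move=> _ [C cC [D sD <-]].
have sC := gen_sigma_cylinders Z n C cC.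
(* The cylinder and the event of [Z n] are grouped: both belong to the sigma-algebra of [Z], so [D]
   splits off. Then [Z n] splits from the cylinder, and the cylinder and [D] are joined again. *)
rewrite setIAC [LHS]indZZ'//; last first.
  by apply: gen_sigmaI => //; exact: gen_sigma_preimage.
by rewrite cylinders_indep// (indZZ' C)// -!muleA [(P D * _)%E]muleC.
Qed.

Lemma history_past Z Z' n j B : (j < n)%N -> measurable B ->
  history Z Z' n (Z j @^-1` B).
Proof.
move=> jn mB; exists (Z j @^-1` B); last first.
  by exists setT; [exact: gen_sigmaT|rewrite setIT].
exists (fun i => if i == j then B else setT); first by move=> i; case: ifP.
apply/seteqP; split => [w Bw i _ /=|w /(_ j jn) /=]; last by rewrite eqxx.
by case: eqP => [->|].
Qed.

Lemma history_other Z Z' n j B : measurable B -> history Z Z' n (Z' j @^-1` B).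
Proof.
move=> mB; exists setT; first exact: cylindersT.
by exists (Z' j @^-1` B); [exact: gen_sigma_preimage|rewrite setTI].
Qed.

End independence.

(** * Integrating out an independent variable with the other one frozen *)

Section freezing.
Local Open Scope ereal_scope.
Context {d d1 : measure_display} {T : measurableType d} {T1 : measurableType d1}
  {d2 : measure_display} {T2 : measurableType d2} {R : realType}.

(** By independence the law of the pair is the product of the laws, and Tonelli's theorem reduces
    the claim to the inner integral at fixed [u]. In the application [U] is the identity of [T] into
    [T] with a smaller sigma-algebra, so this replaces conditional expectations. *)
Lemma ge0_integral_indep_le (P : probability T R) (U : T -> T1) (Y : T -> T2)
    (f : (T1 * T2)%type -> \bar R) (g : T1 -> \bar R) :
  measurable_fun setT U -> measurable_fun setT Y ->
  (forall A B, measurable A -> measurable B ->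
    P (U @^-1` A `&` Y @^-1` B) = P (U @^-1` A) * P (Y @^-1` B)) ->
  measurable_fun setT f -> (forall z, 0 <= f z) ->
  measurable_fun setT g -> (forall u, \int[P]_v f (u, Y v) <= g u) ->
  \int[P]_w f (U w, Y w) <= \int[P]_w g (U w).
Proof.
move=> mU mY indUY mf f0 mg fg.
pose mfU := isMeasurableFun.Build _ _ _ _ U mU.
pose mfY := isMeasurableFun.Build _ _ _ _ Y mY.
pose U' : {mfun T >-> T1} := HB.pack U mfU.
pose Y' : {mfun T >-> T2} := HB.pack Y mfY.
have mUY : measurable_fun setT (fun w => (U w, Y w)).
  exact: measurable_fun_pair.
rewrite -[leLHS](@ge0_integral_pushforward _ _ _ _ _ _ mUY P setT f)//.
rewrite (@eq_measure_integral _ _ _ _ (distribution P U' \x distribution P Y')); last first.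
  by move=> A mA _; apply/esym/product_measure_unique => // B C mB mC; exact: indUY.
rewrite fubini_tonelli1//= (ge0_integral_pushforward mU)//=; first last.
- by move=> x _; apply: integral_ge0.
- exact: measurable_fun_fubini_tonelli_F.
have FE u : fubini_F (distribution P Y') f u = \int[P]_v f (u, Y v).
  rewrite /fubini_F (ge0_integral_pushforward mY)//=.
  exact: measurableT_comp.
rewrite preimage_setT; apply: ge0_le_integral => //=.
- by move=> w _; apply: integral_ge0.
- by apply: measurableT_comp => //; exact: measurable_fun_fubini_tonelli_F.
- exact: measurableT_comp.
- by move=> w _; rewrite FE.
Qed.

End freezing.

(** * Integrals of identically distributed variables *)

Section ident_distr.
Local Open Scope ereal_scope.
Context {d d1 : measure_display} {T : measurableType d} {T1 : measurableType d1}
  {R : realType}.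

Lemma ge0_integral_ident_distr (P : probability T R) (X Y : T -> T1)
    (g : T1 -> \bar R) :
  measurable_fun setT X -> measurable_fun setT Y ->
  (forall B, measurable B -> P (X @^-1` B) = P (Y @^-1` B)) ->
  measurable_fun setT g -> (forall z, 0 <= g z) ->
  \int[P]_w g (X w) = \int[P]_w g (Y w).
Proof.
move=> mX mY XY mg g0.
rewrite -[LHS](ge0_integral_pushforward mX P measurableT)//.
rewrite -[RHS](ge0_integral_pushforward mY P measurableT)//.
by apply: eq_measure_integral => A mA _; exact: XY.
Qed.

Lemma integral_ident_distr (P : probability T R) (X Y : T -> T1)
    (g : T1 -> \bar R) :
  measurable_fun setT X -> measurable_fun setT Y ->
  (forall B, measurable B -> P (X @^-1` B) = P (Y @^-1` B)) ->
  measurable_fun setT g ->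
  \int[P]_w g (X w) = \int[P]_w g (Y w).
Proof.
move=> mX mY XY mg; rewrite [LHS]integralE [RHS]integralE.
congr (_ - _).
- rewrite (funepos_comp g X) (funepos_comp g Y).
  apply: (ge0_integral_ident_distr P X Y g^\+ mX mY XY).
  + exact: measurable_funepos.
  + exact: funepos_ge0.
- rewrite (funeneg_comp g X) (funeneg_comp g Y).
  apply: (ge0_integral_ident_distr P X Y g^\- mX mY XY).
  + exact: measurable_funeneg.
  + exact: funeneg_ge0.
Qed.

End ident_distr.

(** * Scalar inequalities *)

Section scalar_bounds.
Context {R : realType}.
Implicit Types x y l q : R.

(** Below 1 the affine part is nonnegative, and above 1 the power dominates [x]. This serves to show
    that the moment bounds are positive, in [moments_gt0]. *)
Lemma ler_1BDpowR x q : 0 <= x -> 1 <= q <= 2 -> 0 <= 1 - x + x `^ q.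
Proof.
move=> x0 /andP[q1 q2]; have [x1|/ltW x1] := leP x 1.
  by rewrite addr_ge0 ?powR_ge0// subr_ge0.
by rewrite -addrA addr_ge0// addrC subr_ge0 -{1}(powRr1 x0) ler_powR.
Qed.

(** For [x >= 1] the left side is at most 1 and the power dominates [x]. For [x <= 1] the square is
    below the power, since [q <= 2], and the case [q = 2] suffices. *)
Lemma expRN_le x q : 0 <= x -> 1 <= q <= 2 -> expR (- x) <= 1 - x + x `^ q.
Proof.
move=> x0 /andP[q1 q2]; have [x1|/ltW x1] := leP x 1; last first.
  apply: (@le_trans _ _ 1); first by rewrite -expR0 ler_expR oppr_le0.
  by rewrite -addrA lerDl addrC subr_ge0 -{1}(powRr1 x0) ler_powR.
apply: (@le_trans _ _ (1 - x + x ^+ 2)); last first.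
  rewrite lerD2l; have [->|xN0] := eqVneq x 0.
    by rewrite expr0n/= powR_ge0.
  rewrite -powR_mulrn//; apply: ger_powR => //.
  by rewrite lt_neqAle eq_sym xN0 x0.
(* After multiplication by [expR x >= 1 + x], the claim follows from (1 - x + x^2)(1 + x) = 1 +
   x^3. *)
rewrite expRN -[leLHS]mul1r ler_pdivrMr ?expR_gt0//.
have := expR_ge1Dx x; set e := expR x => xe.
have x2 : 0 <= 1 - x + x ^+ 2 by nra.
apply: (le_trans _ (ler_wpM2l x2 xe)).
rewrite (_ : _ * _ = 1 + x ^+ 3); last by ring.
by rewrite lerDl exprn_ge0.
Qed.

(** If y is the larger in absolute value, then (x + y)^2 <= 4 y^2; the constant is 4^q <= 4^2 =
    16. *)
Lemma sqrD_powR_le x y q : 1 <= q <= 2 ->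
  ((x + y) ^+ 2) `^ q <= 16 * (`|x| `^ (2 * q) + `|y| `^ (2 * q)).
Proof.
move=> /andP[q1 q2]; have q0 : 0 <= q by lra.
have dbl z : `|z| `^ (2 * q) = (z ^+ 2) `^ q.
  by rewrite powRrM powR_mulrn// real_normK// num_real.
rewrite !dbl.
wlog xy : x y / x ^+ 2 <= y ^+ 2.
  move=> H; have [/H//|/ltW/H] := leP (x ^+ 2) (y ^+ 2).
  by rewrite [y + x]addrC [in leRHS]addrC.
have le4 : (x + y) ^+ 2 <= 4 * y ^+ 2.
  have := sqr_ge0 (x - y); nra.
apply: (@le_trans _ _ ((4 * y ^+ 2) `^ q)).
  apply: (ge0_ler_powR q0) => //; rewrite nnegrE; first exact: sqr_ge0.
  by apply: mulr_ge0 => //; exact: sqr_ge0.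
rewrite powRM ?sqr_ge0//; apply: ler_pM; rewrite ?powR_ge0//; last first.
  by rewrite lerDr powR_ge0.
apply: (@le_trans _ _ (4 `^ 2)); first by rewrite ler_powR//; lra.
by rewrite powR_mulrn//; lra.
Qed.

(** Taking inverses, exp(1/p - 1/2) >= 1 + 1/p - 1/2 >= 1/p. *)
Lemma expR_invN_le (p : R) : 0 < p -> expR (- p^-1 + 2^-1) <= p.
Proof.
move=> p0; have -> : - p^-1 + 2^-1 = - (p^-1 - 2^-1) by ring.
rewrite -[leRHS]invrK expRN lef_pV2 ?posrE ?expR_gt0 ?invr_gt0//.
by apply: le_trans (expR_ge1Dx _); lra.
Qed.

End scalar_bounds.

(** * One-step estimates: averaging over the noise, then over the fading *)

Section one_step.
Context {d : measure_display} {T : measurableType d} {R : realType}.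
Variable P : probability T R.
Implicit Types (f g h X Y : T -> R) (a b k l m v M q : R).

(** Linearity in the form both steps need, with [f], [g], [h] being a variable, its square and its
    absolute power of order [2 * q]. *)
Lemma integral_affine3 f g h (mf mg mh k0 k1 k2 k3 : R) :
  P.-integrable setT (EFin \o f) -> P.-integrable setT (EFin \o g) ->
  P.-integrable setT (EFin \o h) ->
  (\int[P]_w (f w)%:E = mf%:E)%E -> (\int[P]_w (g w)%:E = mg%:E)%E ->
  (\int[P]_w (h w)%:E = mh%:E)%E ->
  P.-integrable setT
    (fun w => (k0 + k1 * f w + k2 * g w + k3 * h w)%:E) /\
  (\int[P]_w (k0 + k1 * f w + k2 * g w + k3 * h w)%:E =
    (k0 + k1 * mf + k2 * mg + k3 * mh)%:E)%E.
Proof.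
move=> if_ ig ih Ef Eg Eh.
have i0 : P.-integrable setT (cst k0%:E).
  exact: finite_measure_integrable_cst.
have i1 := integrableZl measurableT k1 if_.
have i2 := integrableZl measurableT k2 ig.
have i3 := integrableZl measurableT k3 ih.
have i01 := integrableD measurableT i0 i1.
have i012 := integrableD measurableT i01 i2.
have -> : (fun w => (k0 + k1 * f w + k2 * g w + k3 * h w)%:E) =
  (((cst k0%:E \+ (fun w => k1%:E * (EFin \o f) w)) \+
     (fun w => k2%:E * (EFin \o g) w)) \+ (fun w => k3%:E * (EFin \o h) w))%E by [].
split; first exact: integrableD.
have E0 : (\int[P]_w cst k0%:E w = k0%:E)%E.
  by rewrite integral_cst// [X in (_ * X)%E]probability_setT mule1.
have E1 : (\int[P]_w (k1%:E * (EFin \o f) w) = (k1 * mf)%:E)%E.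
  by rewrite integralZl// Ef.
have E2 : (\int[P]_w (k2%:E * (EFin \o g) w) = (k2 * mg)%:E)%E.
  by rewrite integralZl// Eg.
have E3 : (\int[P]_w (k3%:E * (EFin \o h) w) = (k3 * mh)%:E)%E.
  by rewrite integralZl// Eh.
apply: (etrans (integralD measurableT i012 i3)); rewrite E3 EFinD; congr (_ + _)%E.
apply: (etrans (integralD measurableT i01 i2)); rewrite E2 EFinD; congr (_ + _)%E.
by apply: (etrans (integralD measurableT i0 i1)); rewrite E1 E0.
Qed.

Lemma integrable_norm_powR f q M : 0 <= q -> measurable_fun setT f ->
  (\int[P]_w (`|f w| `^ q)%:E <= M%:E)%E ->
  P.-integrable setT (fun w => (`|f w| `^ q)%:E).
Proof.
move=> q0 mf fM; apply/integrableP; split.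
  apply/measurable_EFinP; apply: (@measurableT_comp _ _ _ _ _ _ (@powR R ^~ q)) => //.
  exact: measurableT_comp.
under eq_integral do rewrite gee0_abs ?lee_fin ?powR_ge0//.
exact: le_lt_trans fM (ltry _).
Qed.

(* [b] is the mean, [v] a lower bound on the second moment and [M] an upper bound
   on the absolute moment of order [2 q]. *)
Definition moments Y q b v M := [/\ measurable_fun setT Y,
  P.-integrable setT (EFin \o Y),
  P.-integrable setT (fun w => (Y w ^+ 2)%:E),
  P.-integrable setT (fun w => (`|Y w| `^ (2 * q))%:E) &
  [/\ (\int[P]_w (Y w)%:E = b%:E)%E,
   (v%:E <= \int[P]_w (Y w ^+ 2)%:E)%E &
   (\int[P]_w (`|Y w| `^ (2 * q))%:E <= M%:E)%E]].

(** Apply [expRN_le] at l (a + Y)^2, expand the square and bound its power by [sqrD_powR_le]. The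
    cross term vanishes because the mean is 0, the second moment enters with a negative sign and so
    needs a lower bound, and the top moment needs an upper one. *)
Lemma noise_step Y q v M l a : 1 <= q <= 2 -> 0 < l -> moments Y q 0 v M ->
  (\int[P]_w (expR (- (l * (a + Y w) ^+ 2)))%:E <=
   (1 - l * (a ^+ 2 + v) + 16 * l `^ q * (`|a| `^ (2 * q) + M))%:E)%E.
Proof.
move=> q12 l0 [mY i1 i2 i3 [E1 E2 E3]].
have /fineK/esym E2' := integrable_fin_num measurableT i2.
have /fineK/esym E3' := integrable_fin_num measurableT i3.
rewrite E2' lee_fin in E2; rewrite E3' lee_fin in E3.
set v' := fine _ in E2 E2'; set M' := fine _ in E3 E3'.
(* Coefficients of 1, Y, Y^2 and |Y|^(2q) in the expanded upper bound. *)
have [iA EA] := @integral_affine3 _ _ _ _ _ _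
  (1 - l * a ^+ 2 + 16 * l `^ q * `|a| `^ (2 * q))
  (- (2 * l * a)) (- l) (16 * l `^ q) i1 i2 i3 E1 E2' E3'.
apply: (@le_trans _ _ (\int[P]_w (1 - l * a ^+ 2 + 16 * l `^ q * `|a| `^ (2 * q)
   + (- (2 * l * a)) * Y w + (- l) * Y w ^+ 2
   + 16 * l `^ q * `|Y w| `^ (2 * q))%:E)%E); last first.
  rewrite EA lee_fin.
  have : 0 <= l * (v' - v) by rewrite mulr_ge0 ?subr_ge0// ltW.
  have : 0 <= l `^ q * (M - M') by rewrite mulr_ge0 ?subr_ge0// powR_ge0.
  nra.
apply: ge0_le_integral => //=.
- apply/measurable_EFinP; apply: measurableT_comp => //.
  apply: measurableT_comp => //; apply: measurable_funM => //.
  by apply: measurable_funX; apply: measurable_funD.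
- exact: (measurable_int _ iA).
- move=> w _; rewrite lee_fin.
  have z0 : 0 <= l * (a + Y w) ^+ 2 by rewrite mulr_ge0 ?sqr_ge0// ltW.
  apply: (le_trans (expRN_le _ _ z0 q12)).
  rewrite powRM ?sqr_ge0//; last exact: ltW.
  have := ler_wpM2l (powR_ge0 l q) (sqrD_powR_le a (Y w) q q12).
  nra.
Qed.

(** The integrand is the bound of [noise_step] at the shift [a * X w]. It involves only the square
    and the absolute power of [X], so the linear coefficient is 0 and the mean [b] may be
    arbitrary. *)
Lemma signal_step X q b v M s N l a : 1 <= q <= 2 -> 0 < l ->
  moments X q b s N ->
  (\int[P]_w (1 - l * ((a * X w) ^+ 2 + v)
      + 16 * l `^ q * (`|a * X w| `^ (2 * q) + M))%:E <=
   (1 - l * (a ^+ 2 * s + v)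
      + 16 * l `^ q * (`|a| `^ (2 * q) * N + M))%:E)%E.
Proof.
move=> q12 l0 [mY i1 i2 i3 [E1 E2 E3]].
have /fineK/esym E2' := integrable_fin_num measurableT i2.
have /fineK/esym E3' := integrable_fin_num measurableT i3.
rewrite E2' lee_fin in E2; rewrite E3' lee_fin in E3.
set s' := fine _ in E2 E2'; set N' := fine _ in E3 E3'.
have [iA EA] := @integral_affine3 _ _ _ _ _ _
  (1 - l * v + 16 * l `^ q * M)
  0 (- (l * a ^+ 2)) (16 * l `^ q * `|a| `^ (2 * q)) i1 i2 i3 E1 E2' E3'.
under eq_integral => w _.
  rewrite (_ : _ + _ = (1 - l * v + 16 * l `^ q * M) + 0 * X w
    + (- (l * a ^+ 2)) * X w ^+ 2
    + (16 * l `^ q * `|a| `^ (2 * q)) * `|X w| `^ (2 * q)); last first.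
    by rewrite normrM powRM//; ring.
  over.
rewrite EA lee_fin.
have : 0 <= l * (a ^+ 2) * (s' - s).
  by apply: mulr_ge0; [apply: mulr_ge0; [exact: ltW|exact: sqr_ge0]|rewrite subr_ge0].
have : 0 <= l `^ q * `|a| `^ (2 * q) * (N - N').
  by apply: mulr_ge0; [apply: mulr_ge0; exact: powR_ge0|rewrite subr_ge0].
nra.
Qed.

End one_step.

(** * The conditional exponential estimate at one time *)

Section exponential_bound.
Context {d : measure_display} {T : measurableType d} {R : realType}.
Implicit Types (eps eta : nat -> T -> R) (W X : T -> R) (q l zlo zhi s v M N : R).

(** Passing to the measurable space carried by the generated sigma-algebra gives access to the
    closure properties of measurable functions. *)
Lemma measurable_wrt_g_sigma (G : set (set T)) (f : T -> R) :
  measurable_wrt <<s G >> f <->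
  measurable_fun setT (f : g_sigma_algebraType G -> R).
Proof.
split=> [mf _ B mB|mf B mB]; first by rewrite setTI; exact: mf.
by have := mf measurableT B mB; rewrite setTI.
Qed.

Lemma filtr_sub_history_eps eps eta i :
  filtr eps eta i `<=` <<s history eps eta i >>.
Proof.
apply: smallest_sub; first exact: smallest_sigma_algebra.
move=> _ [j [B [ji [mB [->|->]]]]]; apply: sub_sigma_algebra.
  exact: history_past.
exact: history_other.
Qed.

Lemma filtr_sub_history_eta eps eta i :
  filtr eps eta i `<=` <<s history eta eps i >>.
Proof.
apply: smallest_sub; first exact: smallest_sigma_algebra.
move=> _ [j [B [ji [mB [->|->]]]]]; apply: sub_sigma_algebra.
  exact: history_other.
exact: history_past.
Qed.

Lemma indep_seq_sym (P : probability T R) (Z Z' : nat -> T -> R) :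
  indep_seq P Z Z' -> indep_seq P Z' Z.
Proof. by move=> ind A B sA sB; rewrite setIC ind// muleC. Qed.

Lemma measurable_norm_powR d1 (T1 : measurableType d1) (f : T1 -> R) q :
  measurable_fun setT f -> measurable_fun setT (fun w => `|f w| `^ q).
Proof.
move=> mf; apply: (@measurableT_comp _ _ _ _ _ _ (@powR R ^~ q)) => //.
exact: measurableT_comp.
Qed.

(** A conditional bound expressed by testing against every nonnegative past-measurable weight [W].
    First [eta i] is averaged with the past and [eps] frozen, then [eps i] with the past frozen. *)
Lemma exp_step (P : probability T R) eps eta i W X q l zlo zhi b s v M N :
  (forall j, measurable_fun setT (eps j)) ->
  (forall j, measurable_fun setT (eta j)) ->
  mutually_independent P eps -> mutually_independent P eta ->
  indep_seq P eta eps ->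
  1 <= q <= 2 -> 0 < l -> 0 <= zlo -> 0 <= s -> 0 <= N ->
  moments P (eps i) q b s N -> moments P (eta i) q 0 v M ->
  measurable_wrt (filtr eps eta i) W -> measurable_wrt (filtr eps eta i) X ->
  (forall w, 0 <= W w) -> (forall w, zlo <= X w <= zhi) ->
  (\int[P]_w (W w * expR (- (l * (eps i w * X w + eta i w) ^+ 2)))%:E <=
   (expR (- (l * (zlo ^+ 2 * s + v)) + 16 * l `^ q * (zhi `^ (2 * q) * N + M)))%:E
   * \int[P]_w (W w)%:E)%E.
Proof.
move=> meps meta indeps indeta indee q12 l0 zlo0 s0 N0 momeps mometa mW mX W0 Xz.
set E := expR _.
pose phi c := 1 - l * (c ^+ 2 + v) + 16 * l `^ q * (`|c| `^ (2 * q) + M).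
have noise c := noise_step P (eta i) q v M l c q12 l0 mometa.
(* As an upper bound for the integral of an exponential, [phi] is nonnegative, which makes Tonelli's
   theorem applicable in the second averaging. *)
have phi0 c : 0 <= phi c.
  rewrite -lee_fin; apply: le_trans (noise c); apply: integral_ge0 => w _.
  by rewrite lee_fin expR_ge0.
have mphi : measurable_fun setT phi.
  apply: measurable_funD; first apply: measurable_funB => //.
    by apply: measurable_funM => //; apply: measurable_funD.
  apply: measurable_funM => //; apply: measurable_funD => //.
  exact: measurable_norm_powR.
(* The input is replaced by [zlo] in the negative term and by [zhi] in the positive one, and 1 + x
   <= exp x gives the exponential form. *)
have signal w : (\int[P]_u (phi (X w * eps i u))%:E <= E%:E)%E.
  apply: (le_trans (signal_step P (eps i) q b v M s N l (X w) q12 l0 momeps)).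
  have /andP[zX Xz'] := Xz w; have X0 := le_trans zlo0 zX.
  rewrite lee_fin; apply: (le_trans _ (expR_ge1Dx _)).
  have lq0 := powR_ge0 l q.
  have h1 : 0 <= l * s * (X w ^+ 2 - zlo ^+ 2).
    apply: mulr_ge0; first by rewrite mulr_ge0// ltW.
    by rewrite subr_ge0 lerXn2r.
  have h2 : 0 <= l `^ q * N * (zhi `^ (2 * q) - `|X w| `^ (2 * q)).
    apply: mulr_ge0; first exact: mulr_ge0.
    rewrite subr_ge0 (ger0_norm X0); apply: ge0_ler_powR => //.
      by case/andP: q12 => *; lra.
    by rewrite nnegrE; exact: le_trans Xz'.
  nra.
have sub_id (G : set (set T)) : G `<=` measurable ->
    measurable_fun setT (id : T -> g_sigma_algebraType G).
  move=> Gm _ B sB; rewrite setTI.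
  by move: B sB; apply: smallest_sub => //; exact: sigma_algebra_measurable.
have hist_fun (Z Z' : nat -> T -> R) (f : T -> R) :
    filtr eps eta i `<=` <<s history Z Z' i >> ->
    measurable_wrt (filtr eps eta i) f ->
    measurable_fun setT (f : g_sigma_algebraType (history Z Z' i) -> R).
  by move=> sub mf; apply/measurable_wrt_g_sigma => B mB; exact: (sub _ (mf B mB)).
(* [history eta eps i] contains the past and the whole of [eps]. *)
have step1 : (\int[P]_w (W w * expR (- (l * (X w * eps i w + eta i w) ^+ 2)))%:E
    <= \int[P]_w (W w * phi (X w * eps i w))%:E)%E.
  pose H := history eta eps i.
  have mWH : measurable_fun setT (W : g_sigma_algebraType H -> R).
    by apply: hist_fun => //; exact: filtr_sub_history_eta.
  have mXH : measurable_fun setT (X : g_sigma_algebraType H -> R).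
    by apply: hist_fun => //; exact: filtr_sub_history_eta.
  have meH : measurable_fun setT (eps i : g_sigma_algebraType H -> R).
    apply/measurable_wrt_g_sigma => B mB; apply: sub_sigma_algebra.
    exact: history_other.
  pose f (z : g_sigma_algebraType H * R) :=
    (W z.1 * expR (- (l * (X z.1 * eps i z.1 + z.2) ^+ 2)))%:E.
  pose g (u : g_sigma_algebraType H) := (W u * phi (X u * eps i u))%:E.
  apply: (ge0_integral_indep_le P (id : T -> g_sigma_algebraType H) (eta i) f g).
  - by apply: sub_id; exact: history_measurable.
  - by [].
  - by move=> A B mA mB; exact: history_indep.
  - apply/measurable_EFinP; apply: measurable_funM; first exact: measurableT_comp.
    apply: measurableT_comp => //; apply: measurableT_comp => //.
    apply: measurable_funM => //; apply: measurable_funX; apply: measurable_funD => //.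
    by apply: measurable_funM; exact: measurableT_comp.
  - by move=> z; rewrite lee_fin mulr_ge0 ?expR_ge0.
  - apply/measurable_EFinP; apply: measurable_funM => //.
    by apply: measurableT_comp => //; exact: measurable_funM.
  - move=> u; rewrite /f /g /=; under eq_integral do rewrite EFinM.
    rewrite ge0_integralZl//= ?lee_fin//; last first.
      apply/measurable_EFinP; apply: measurableT_comp => //.
      apply: measurableT_comp => //; apply: measurable_funM => //.
      by apply: measurable_funX; apply: measurable_funD.
    by rewrite EFinM lee_wpmul2l ?lee_fin.
(* The roles are exchanged: [history eps eta i] contains the past and the whole of [eta], and
   [eps i] is the fresh variable. *)
have step2 : (\int[P]_w (W w * phi (X w * eps i w))%:E <=
    \int[P]_w (W w * E)%:E)%E.
  pose H := history eps eta i.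
  have mWH : measurable_fun setT (W : g_sigma_algebraType H -> R).
    by apply: hist_fun => //; exact: filtr_sub_history_eps.
  have mXH : measurable_fun setT (X : g_sigma_algebraType H -> R).
    by apply: hist_fun => //; exact: filtr_sub_history_eps.
  pose f (z : g_sigma_algebraType H * R) := (W z.1 * phi (X z.1 * z.2))%:E.
  pose g (u : g_sigma_algebraType H) := (W u * E)%:E.
  apply: (ge0_integral_indep_le P (id : T -> g_sigma_algebraType H) (eps i) f g).
  - by apply: sub_id; exact: history_measurable.
  - by [].
  - have indes := indep_seq_sym P eta eps indee.
    move=> A B mA mB; exact: (history_indep P eps eta i A B meps meta indeps indes mA mB).
  - apply/measurable_EFinP; apply: measurable_funM; first exact: measurableT_comp.
    apply: measurableT_comp => //; apply: measurable_funM => //.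
    exact: measurableT_comp.
  - by move=> z; rewrite lee_fin mulr_ge0.
  - by apply/measurable_EFinP; apply: measurable_funM.
  - move=> u; rewrite /f /g /=; under eq_integral do rewrite EFinM.
    rewrite ge0_integralZl//= ?lee_fin//; last first.
    + by move=> w _; rewrite lee_fin.
    + apply/measurable_EFinP; apply: measurableT_comp => //.
      exact: measurable_funM.
    by rewrite EFinM lee_wpmul2l ?lee_fin.
under eq_integral do rewrite [eps i _ * _]mulrC.
apply: (le_trans step1); apply: (le_trans step2).
under eq_integral do rewrite mulrC EFinM.
rewrite ge0_integralZl ?lee_fin ?expR_ge0//.
- apply/measurable_EFinP => _ B mB; rewrite setTI.
  have := filtr_sub_history_eps eps eta i _ (mW B mB); move: (W @^-1` B).
  apply: smallest_sub; first exact: sigma_algebra_measurable.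
  exact: history_measurable.
- by move=> w _; rewrite lee_fin.
Qed.

End exponential_bound.

(** * Iteration over time *)

Section exponential_chain.
Context {d : measure_display} {T : measurableType d} {R : realType}.
Implicit Types (eps eta X : nat -> T -> R) (q l zlo zhi s v M N : R).

Lemma filtr_mono eps eta i j : (i <= j)%N -> filtr eps eta i `<=` filtr eps eta j.
Proof.
move=> ij; apply: smallest_sub; first exact: smallest_sigma_algebra.
move=> A [k [B [ki [mB AE]]]]; apply: sub_sigma_algebra.
by exists k, B; split; [exact: leq_trans ki ij|].
Qed.

(** The terms of index below [k] involve only [eps] and [eta] before time [k], and inputs that are
    predictable. Hence the exponential of the partial energy is an admissible weight at time [k]. *)
Lemma measurable_wrt_energy eps eta X zlo zhi n k : (k <= n)%N ->
  Sigma_inputs eps eta zlo zhi n X ->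
  measurable_wrt (filtr eps eta k)
    (fun w => \sum_(i < k) (eps i w * X i w + eta i w) ^+ 2).
Proof.
move=> kn SX; apply/measurable_wrt_g_sigma; apply: measurable_sum => i.
have ik := ltn_ord i.
have [mX _] := SX i (leq_trans ik kn).
apply: measurable_funX; apply: measurable_funD; first apply: measurable_funM.
- apply/measurable_wrt_g_sigma => B mB; apply: sub_sigma_algebra.
  by exists i, B; split=> //; split=> //; left.
- apply/measurable_wrt_g_sigma => B mB.
  exact: (filtr_mono eps eta i k (ltnW ik) _ (mX B mB)).
- apply/measurable_wrt_g_sigma => B mB; apply: sub_sigma_algebra.
  by exists i, B; split=> //; split=> //; right.
Qed.

Lemma exp_energy (P : probability T R) eps eta X q l zlo zhi b s v M N n :
  (forall j, measurable_fun setT (eps j)) ->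
  (forall j, measurable_fun setT (eta j)) ->
  mutually_independent P eps -> mutually_independent P eta ->
  indep_seq P eta eps ->
  1 <= q <= 2 -> 0 < l -> 0 <= zlo -> 0 <= s -> 0 <= N ->
  (forall i, moments P (eps i) q b s N) -> (forall i, moments P (eta i) q 0 v M) ->
  Sigma_inputs eps eta zlo zhi n X ->
  (\int[P]_w (expR (- (l * \sum_(i < n) (eps i w * X i w + eta i w) ^+ 2)))%:E <=
   (expR (- (l * (zlo ^+ 2 * s + v))
      + 16 * l `^ q * (zhi `^ (2 * q) * N + M)) ^+ n)%:E)%E.
Proof.
move=> meps meta indeps indeta indee q12 l0 zlo0 s0 N0 momeps mometa SX.
set E := expR (_ + _).
(* Induction on the partial sums; the bound [k <= n] is kept because the inputs are controlled only
   before time [n]. *)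
suff H k : (k <= n)%N -> (\int[P]_w (expR (- (l *
    \sum_(i < k) (eps i w * X i w + eta i w) ^+ 2)))%:E <= (E ^+ k)%:E)%E by exact: H.
elim: k => [_|k IHk kn].
  under eq_integral do rewrite big_ord0 mulr0 oppr0 expR0.
  by rewrite integral_cst// [X in (_ * X)%E]probability_setT mule1 expr0.
under eq_integral do rewrite big_ord_recr/= mulrDr opprD expRD.
have [mX Xz] := SX k kn.
(* The weight is the exponential of the first [k] terms, so each step contributes one factor [E]. *)
have step := exp_step P eps eta k
  (fun w => expR (- (l * \sum_(i < k) (eps i w * X i w + eta i w) ^+ 2))) (X k)
  q l zlo zhi b s v M N meps meta indeps indeta indee q12 l0 zlo0 s0 N0
  (momeps k) (mometa k).
apply: le_trans (step _ mX _ Xz) _.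
- have := measurable_wrt_energy eps eta X zlo zhi n k (ltnW kn) SX.
  move=> /measurable_wrt_g_sigma mS; apply/measurable_wrt_g_sigma.
  by apply: measurableT_comp => //; apply: measurableT_comp => //; exact: measurable_funM.
- by move=> w; exact: expR_ge0.
- by rewrite [E ^+ k.+1]exprS EFinM lee_wpmul2l ?lee_fin ?expR_ge0// IHk// ltnW.
Qed.

End exponential_chain.

(** * Moment conditions *)

Section moments.
Context {d : measure_display} {T : measurableType d} {R : realType}.
Variable P : probability T R.
Implicit Types (X Y : T -> R) (q b s M : R).

Lemma moments_ident_distr X Y q b s M : measurable_fun setT Y ->
  (forall B, measurable B -> P (Y @^-1` B) = P (X @^-1` B)) ->
  moments P X q b s M -> moments P Y q b s M.
Proof.
move=> mY YX [mX iX iX2 iXq [EX EX2 EXq]].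
have eqI (g : R -> R) : measurable_fun setT g ->
    (\int[P]_w (g (Y w))%:E = \int[P]_w (g (X w))%:E)%E.
  by move=> mg; apply: (integral_ident_distr P Y X (EFin \o g)) => //; exact/measurable_EFinP.
have eqInt (g : R -> R) : measurable_fun setT g ->
    P.-integrable setT (fun w => (g (X w))%:E) ->
    P.-integrable setT (fun w => (g (Y w))%:E).
  move=> mg /integrableP[_ fin]; apply/integrableP; split.
    by apply/measurable_EFinP; exact: measurableT_comp.
  move: fin; congr (_ < _)%E; apply/esym.
  by apply: (eqI (fun x => `|g x|)); exact: measurableT_comp.
have msqr : measurable_fun setT (fun x : R => x ^+ 2) by exact: measurable_funX.
have mpow : measurable_fun setT (fun x : R => `|x| `^ (2 * q)).
  exact: measurable_norm_powR.
split=> //.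
- exact: (eqInt id).
- exact: (eqInt (fun x => x ^+ 2)).
- exact: (eqInt (fun x => `|x| `^ (2 * q))).
split; first by rewrite (eqI id).
  by rewrite (eqI (fun x => x ^+ 2)).
by rewrite (eqI (fun x => `|x| `^ (2 * q))).
Qed.

(** Integrability of [X] comes from |X| <= 1 + X^2, and then [fine] returns the true mean. *)
Lemma momentsI X q s M : 0 <= q -> measurable_fun setT X ->
  (\int[P]_w (X w ^+ 2)%:E < +oo)%E ->
  (s%:E <= \int[P]_w (X w ^+ 2)%:E)%E ->
  (\int[P]_w (`|X w| `^ (2 * q))%:E <= M%:E)%E ->
  moments P X q (fine (\int[P]_w (X w)%:E)%E) s M.
Proof.
move=> q0 mX X2oo sX2 XqM.
have iX2 : P.-integrable setT (fun w => (X w ^+ 2)%:E).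
  apply/integrableP; split.
    by apply/measurable_EFinP; exact: measurable_funX.
  by under eq_integral do rewrite gee0_abs ?lee_fin ?sqr_ge0//.
have iX : P.-integrable setT (EFin \o X).
  apply: (le_integrable measurableT (g := (cst 1%:E \+ (fun w => (X w ^+ 2)%:E))%E)).
  - exact/measurable_EFinP.
  - move=> w _ /=; rewrite lee_fin [leRHS]ger0_norm; last first.
      by rewrite addr_ge0 ?sqr_ge0.
    by rewrite ler_norml; apply/andP; split; nra.
  - by apply: integrableD => //; exact: finite_measure_integrable_cst.
split=> //.
  by apply: (integrable_norm_powR P X (2 * q) M) => //; rewrite mulr_ge0.
by split=> //; rewrite fineK//; exact: integrable_fin_num.
Qed.

(** If [M <= 0], then [signal_step] bounds by a negative number the integral of a function that is
    nonnegative by [ler_1BDpowR]. *)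
Lemma moments_gt0 X q b s M : 1 <= q <= 2 -> 0 < s ->
  moments P X q b s M -> 0 < M.
Proof.
move=> q12 s0 momX; rewrite ltNge; apply/negP => M0.
(* With this rate the affine part of the bound is 1 - 2 = -1. *)
have l0 : 0 < 2 / s by rewrite divr_gt0.
have := signal_step P X q b 0 0 s M (2 / s) 1 q12 l0 momX.
apply/negP; rewrite -ltNge; apply: (@lt_le_trans _ _ 0%E).
  rewrite lte_fin normr1 powR1 expr1n !addr0 !mul1r divfK ?gt_eqF//.
  have : 16 * (2 / s) `^ q * M <= 0 by rewrite mulr_ge0_le0// mulr_ge0// powR_ge0.
  lra.
apply: integral_ge0 => w _; rewrite lee_fin !addr0 mul1r.
set u := 2 / s * X w ^+ 2.
have u0 : 0 <= u by rewrite mulr_ge0 ?sqr_ge0// ltW.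
have uq : u `^ q = (2 / s) `^ q * `|X w| `^ (2 * q).
  by rewrite powRM ?sqr_ge0 ?(ltW l0)// powRrM powR_mulrn// real_normK// num_real.
have := ler_1BDpowR _ _ u0 q12; rewrite uq.
have := mulr_ge0 (powR_ge0 (2 / s) q) (powR_ge0 `|X w| (2 * q)).
nra.
Qed.


End moments.

(** * Choice of the rate, and Markov's inequality *)

Section calibration.
Context {R : realType}.
Implicit Types (alpha p K : R).

(* At this rate the linear term of the Chernoff exponent is [- 1 / p] and the
   term of order [1 + alpha] is [1 / 2]. *)
Lemma rate_exists alpha K (n : nat) : 0 < alpha -> 0 < K -> (0 < n)%N ->
  exists l : R, [/\ 0 < l,
    n%:R * l * K `^ (1 / (1 + alpha)) = n%:R `^ (alpha / (1 + alpha)) &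
    n%:R * l `^ (1 + alpha) * K = 1].
Proof.
move=> a0 K0 n0; have nR : 0 < n%:R :> R by rewrite ltr0n.
have q0 : 1 + alpha != 0 by rewrite gt_eqF// addr_gt0.
(* The last identity forces this value; in the middle one the powers of [K] cancel and 1 - 1/(1 +
   alpha) = alpha/(1 + alpha). *)
exists ((n%:R * K) `^ (- (1 / (1 + alpha)))); split.
- by rewrite powR_gt0// mulr_gt0.
- rewrite powRM ?ltW// [K `^ - _]powRN -!mulrA mulVf ?gt_eqF ?powR_gt0// mulr1.
  rewrite -{1}(powRr1 (ltW nR)) -powRD; last by apply/implyP => _; rewrite gt_eqF.
  by congr (_ `^ _); field.
- rewrite -powRrM (_ : - (1 / (1 + alpha)) * (1 + alpha) = - 1); last by field.
  rewrite powR_inv1; last by rewrite mulr_ge0 ?ltW.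
  by field; rewrite !gt_eqF.
Qed.

End calibration.

(** Since [l > 0], the event is that [expR (- (l * S w))] is at least [expR (- (l * x))], and
    Markov's inequality applies. *)
Lemma expR_lower_tail {d : measure_display} {T : measurableType d} {R : realType}
    (P : probability T R) (S : T -> R) (l x : R) :
  measurable_fun setT S -> 0 < l ->
  ((expR (- (l * x)))%:E * P [set w | (S w <= x)%R] <=
   \int[P]_w (expR (- (l * S w)))%:E)%E.
Proof.
move=> mS l0.
have mexp : measurable_fun setT (fun w => (expR (- (l * S w)))%:E).
  apply/measurable_EFinP; apply: measurableT_comp => //.
  by apply: measurableT_comp => //; exact: measurable_funM.
have := @le_integral_comp_abse _ _ _ P setT measurableT _
  (expR (- (l * x))) id (@measurable_id _ _ setT) (fun _ h => h)
  (fun _ _ _ _ h => h) mexp (expR_gt0 _).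
under eq_integral do rewrite gee0_abs ?lee_fin ?expR_ge0//.
apply: le_trans; rewrite setTI le_eqVlt; apply/orP; left; apply/eqP.
congr (_ * P _)%E; apply/seteqP; split => w /=;
  by rewrite ger0_norm ?expR_ge0// lee_fin ler_expR lerN2 ler_pM2l.
Qed.

(** * From upper and lower expectations to each single measure *)

Section upper_expectation.
Context {d : measure_display} {T : measurableType d} {R : realType}.
Implicit Types (Pfam : set (probability T R)) (f : T -> R).

Lemma integral_le_upper_E Pfam P f : Pfam P ->
  (\int[P]_w (f w)%:E <= upper_E Pfam f)%E.
Proof. by move=> PP; apply: ereal_sup_ubound; exists P. Qed.

(** Finiteness ensures that [fine] gives the upper expectation itself and not the default value
    0. *)
Lemma integral_le_fine_upper_E Pfam P f : Pfam P -> (forall w, 0 <= f w) ->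
  (upper_E Pfam f < +oo)%E ->
  (\int[P]_w (f w)%:E <= (fine (upper_E Pfam f))%:E)%E.
Proof.
move=> PP f0 foo; rewrite fineK ?integral_le_upper_E// ge0_fin_numE//.
apply: le_trans (integral_le_upper_E Pfam P f PP).
by apply: integral_ge0 => w _; rewrite lee_fin.
Qed.

Lemma lower_E_le_integral Pfam P f (s : R) : Pfam P -> (forall w, 0 <= f w) ->
  oppe (upper_E Pfam (fun w => - f w)) = s%:E ->
  (s%:E <= \int[P]_w (f w)%:E)%E.
Proof.
move=> PP f0 <-; rewrite leeNl -integral_ge0N; last first.
  by move=> w _; rewrite lee_fin.
exact: integral_le_upper_E.
Qed.

End upper_expectation.

(** * Assembly of the missed-detection bound *)

Theorem theorem4p1 (d : measure_display) (T : measurableType d) (R : realType)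
  (Pfam : set (probability T R)) (eps eta : nat -> T -> R)
  (alpha sig_hi sig_lo nu_hi nu_lo zlo zhi p : R) (n : nat) :
  (forall i, measurable_fun setT (eps i)) ->
  (forall i, measurable_fun setT (eta i)) ->
  (forall P, Pfam P -> iid P eps /\ iid P eta /\ indep_seq P eta eps) ->
  0 < alpha <= 1 ->
  upper_E Pfam (fun w => eps 0%N w ^+ 2) = (sig_hi ^+ 2)%:E ->
  oppe (upper_E Pfam (fun w => - (eps 0%N w ^+ 2))) = (sig_lo ^+ 2)%:E ->
  0 < sig_lo ^+ 2 ->
  Order.lt (upper_E Pfam (fun w => `|eps 0%N w| `^ (2 + 2 * alpha))) +oo%E ->
  upper_E Pfam (eta 0%N) = 0%E ->
  upper_E Pfam (fun w => - eta 0%N w) = 0%E ->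
  upper_E Pfam (fun w => eta 0%N w ^+ 2) = (nu_hi ^+ 2)%:E ->
  oppe (upper_E Pfam (fun w => - (eta 0%N w ^+ 2))) = (nu_lo ^+ 2)%:E ->
  0 < nu_lo ^+ 2 ->
  Order.lt (upper_E Pfam (fun w => `|eta 0%N w| `^ (2 + 2 * alpha))) +oo%E ->
  0 < zlo -> zlo < zhi ->
  0 < p ->
  (0 < n)%N ->
  let C := (32 * zhi `^ (2 + 2 * alpha)
              * fine (upper_E Pfam (fun w => `|eps 0%N w| `^ (2 + 2 * alpha)))
            + 32 * fine (upper_E Pfam (fun w => `|eta 0%N w| `^ (2 + 2 * alpha))))
             `^ (1 / (1 + alpha)) in
  let gamma := sig_lo ^+ 2 * zlo ^+ 2 + nu_lo ^+ 2
               - C / (p * n%:R `^ (alpha / (1 + alpha))) in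
  Order.le (ereal_sup [set P [set w | \sum_(i < n) (eps i w * X i w + eta i w) ^+ 2
                               <= n%:R * gamma]
             | P in Pfam & X in Sigma_inputs eps eta zlo zhi n])
     p%:E.
Proof.
move=> meps meta hP /andP[a0 a1] Hsig_hi Hsig_lo sig0 HepsM Heta HetaN Hnu_hi Hnu_lo
  nu0 HetaM zlo0 zlohi p0 n0; cbv zeta.
apply: ge_ereal_sup => _ [P PP [X SX <-]].
have [[indeps ideps] [[indeta ideta] indee]] := hP P PP.
pose q := 1 + alpha.
have q12 : 1 <= q <= 2 by rewrite /q; apply/andP; split; lra.
have q0 : 0 <= q by rewrite /q; lra.
have E2q : 2 + 2 * alpha = 2 * q by rewrite /q; ring.
rewrite !E2q in HepsM HetaM *.
set N := fine (upper_E _ (fun w => `|eps 0%N w| `^ _)).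
set M := fine (upper_E _ (fun w => `|eta 0%N w| `^ _)).
(* This is the base of the power that defines the constant of the test, before the exponent 1/(1 +
   alpha) is applied. *)
set C := (X in X `^ _).
set gamma := (_ - _).
have momeps : moments P (eps 0%N) q (fine (\int[P]_w (eps 0%N w)%:E)%E)
    (sig_lo ^+ 2) N.
  apply: momentsI => //.
  - by apply: (le_lt_trans (integral_le_upper_E Pfam P _ PP)); rewrite Hsig_hi ltry.
  - by apply: (lower_E_le_integral Pfam P _ _ PP _ Hsig_lo) => w; exact: sqr_ge0.
  - by apply: integral_le_fine_upper_E => // w; exact: powR_ge0.
have mometa : moments P (eta 0%N) q 0 (nu_lo ^+ 2) M.
  have : moments P (eta 0%N) q (fine (\int[P]_w (eta 0%N w)%:E)%E) (nu_lo ^+ 2) M.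
    apply: momentsI => //.
    - by apply: (le_lt_trans (integral_le_upper_E Pfam P _ PP)); rewrite Hnu_hi ltry.
    - by apply: (lower_E_le_integral Pfam P _ _ PP _ Hnu_lo) => w; exact: sqr_ge0.
    - by apply: integral_le_fine_upper_E => // w; exact: powR_ge0.
  case=> m1 i1 i2 i3 [e1 e2 e3]; split=> //; split=> //.
  (* The mean of the noise is 0 under each single [P]: the upper expectations of [eta 0] and of its
     opposite give the two inequalities. *)
  apply/eqP; rewrite eq_le; apply/andP; split.
    by have := integral_le_upper_E Pfam P (eta 0%N) PP; rewrite Heta.
  have := integral_le_upper_E Pfam P (fun w => - eta 0%N w) PP; rewrite HetaN.
  under eq_integral do rewrite EFinN -mulN1e.
  by rewrite integralZl// mulN1e leeNl oppe0.
have N0 := moments_gt0 P (eps 0%N) q _ _ _ q12 sig0 momeps.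
have M0 := moments_gt0 P (eta 0%N) q _ _ _ q12 nu0 mometa.
clearbody N M.
pose K := zhi `^ (2 * q) * N + M.
have zhi0 : 0 < zhi by exact: lt_trans zlohi.
have K0 : 0 < K.
  by apply: addr_gt0; [apply: mulr_gt0; [exact: powR_gt0|exact: N0]|exact: M0].
have CE : C = 32 * K by rewrite /C /K; ring.
have C0 : 0 < C by rewrite CE mulr_gt0.
(* The rate is calibrated at [C = 32 * K], so that the term of order [q] in the exponent,
   [16 K n l^q], equals 1/2. *)
have [l [l0 lC lK]] := rate_exists alpha C n a0 C0 n0.
have nR : 0 < n%:R :> R by rewrite ltr0n.
pose S w := \sum_(i < n) (eps i w * X i w + eta i w) ^+ 2.
have expS := exp_energy P eps eta X q l zlo zhi _ _ _ _ _ n meps meta indeps indeta indee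
  q12 l0 (ltW zlo0) (ltW sig0) (ltW N0)
  (fun i => moments_ident_distr P _ _ _ _ _ _ (meps i) (ideps i) momeps)
  (fun i => moments_ident_distr P _ _ _ _ _ _ (meta i) (ideta i) mometa) SX.
rewrite -/K -expRM_natl in expS.
have mS : measurable_fun setT S.
  apply: measurable_sum => i; have [mX _] := SX i (ltn_ord i).
  apply: measurable_funX; apply: measurable_funD => //; apply: measurable_funM => //.
  move=> _ B mB; rewrite setTI; have := mX B mB; move: (X i @^-1` B).
  apply: smallest_sub; first exact: sigma_algebra_measurable.
  by move=> _ [j [D [_ [mD [->|->]]]]]; rewrite -[X in measurable X]setTI;
    [exact: meps|exact: meta].
have PS := le_trans (expR_lower_tail P S l (n%:R * gamma) mS l0) expS.
have eq0 : 0 < expR (- (l * (n%:R * gamma))) by exact: expR_gt0.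
(* Both sides are multiplied by the positive factor from Markov's inequality, to be cancelled at the
   end. *)
rewrite -(@lee_pmul2l _ (expR (- (l * (n%:R * gamma))))%:E) ?lte_fin//.
apply: (le_trans PS); rewrite -EFinM lee_fin.
set m := zlo ^+ 2 * sig_lo ^+ 2 + nu_lo ^+ 2.
have r0 : 0 < n%:R `^ (alpha / (1 + alpha)) :> R by exact: powR_gt0.
(* By the choice of [l], the correction in [gamma] times [n * l] is exactly 1/p. *)
have gammaE : n%:R * l * gamma = n%:R * l * m - p^-1.
  rewrite /gamma mulrBr; congr (_ - _); first by rewrite /m; ring.
  by rewrite mulrA lC; field; rewrite !gt_eqF.
have -> : n%:R * (- (l * m) + 16 * l `^ q * K) =
    - (l * (n%:R * gamma)) + (- p^-1 + 2^-1).
  have -> : n%:R * (- (l * m) + 16 * l `^ q * K) =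
      - (n%:R * l * m) + (n%:R * l `^ q * (32 * K)) / 2 by field.
  have -> : l * (n%:R * gamma) = n%:R * l * gamma by rewrite mulrCA mulrA.
  by rewrite gammaE -CE lK; field; rewrite gt_eqF.
by rewrite expRD ler_pM2l// expR_invN_le.
Qed.
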